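(* For every integer $n \geq 5$, let $\delta(n)$ denote the maximum of $\delta(T)$ over all tournaments $T$ with $n$ vertices. Then $\delta(n) = \left\lceil \frac{n+1}{4} \right\rceil$.
   Context: A tournament $T$ is a finite vertex set $V(T)$ with an arc set $A(T)$ of ordered pairs of distinct vertices such that for all distinct $x,y$, exactly one of $(x,y),(y,x)$ lies in $A(T)$. A module of $T$ is a subset $M \subseteq V(T)$ such that for all $x,y \in M$ and $v \in V(T)\setminus M$, $(v,x)\in A(T)$ iff $(v,y)\in A(T)$. The trivial modules are $\emptyset$, the singletons and $V(T)$; $T$ is indecomposable if all its modules are trivial, decomposable otherwise. For $B \subseteq A(T)$, ${\rm Inv}(T,B)$ is the tournament obtained from $T$ by reversing every arc of $B$. For a tournament $T$ with at least five vertices, the decomposability index $\delta(T)$ is the least integer $m$ such that there is $B \subseteq A(T)$ with $|B| = m$ and ${\rm Inv}(T,B)$ indecomposable. *)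

(* Defs.v *)
From mathcomp Require Import all_boot.

Set Implicit Arguments.
Unset Strict Implicit.
Unset Printing Implicit Defensive.

Section Tournaments.

Variable V : finType.

(* [(+)] is exclusive or: exactly one of the two arcs is present. *)
Record tournament := Tournament {
  arcs : {set V * V};
  arcs_irr : forall x, (x, x) \notin arcs;
  arcs_tot : forall x y, x != y -> ((x, y) \in arcs) (+) ((y, x) \in arcs)
}.

Definition is_module (T : tournament) (M : {set V}) : Prop :=
  forall x y v, x \in M -> y \in M -> v \notin M ->
    ((v, x) \in arcs T) = ((v, y) \in arcs T).

Definition trivial_module (M : {set V}) : Prop :=
  [\/ M = set0, exists x, M = [set x] | M = setT].

Definition indecomposable (T : tournament) : Prop :=
  forall M : {set V}, is_module T M -> trivial_module M.

Definition inv_arcs (T : tournament) (B : {set V * V}) : {set V * V} :=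
  (arcs T :\: B) :|: [set (e.2, e.1) | e in B].

Lemma in_inv_arcs T B x y : ((x, y) \in inv_arcs T B) =
  ((x, y) \in arcs T) && ((x, y) \notin B) || ((y, x) \in B).
Proof.
rewrite /inv_arcs !inE andbC; congr (_ || _).
apply/imsetP/idP => [[[a b] abB [-> ->]] // | yxB].
by exists (y, x).
Qed.

Lemma inv_arcs_irr (T : tournament) (B : {set V * V}) :
  B \subset arcs T -> forall x, (x, x) \notin inv_arcs T B.
Proof.
move=> sBT x; rewrite in_inv_arcs (negbTE (arcs_irr T x)) /=.
by apply: contra (arcs_irr T x); apply: (subsetP sBT).
Qed.

Lemma inv_arcs_tot (T : tournament) (B : {set V * V}) :
  B \subset arcs T -> forall x y, x != y ->
  ((x, y) \in inv_arcs T B) (+) ((y, x) \in inv_arcs T B).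
Proof.
move=> sBT x y /(arcs_tot T); rewrite !in_inv_arcs.
move/subsetP: sBT => sBT; have := sBT (x, y); have := sBT (y, x).
by do 4![case: (_ \in _)] => //= h1 h2; rewrite ?(h1 isT) ?(h2 isT).
Qed.

Definition Inv (T : tournament) (B : {set V * V}) (sBT : B \subset arcs T) :
    tournament :=
  Tournament (inv_arcs_irr sBT) (inv_arcs_tot sBT).

Definition indec_after (T : tournament) (m : nat) : Prop :=
  exists (B : {set V * V}) (sBT : B \subset arcs T),
    #|B| = m /\ indecomposable (Inv sBT).

(* delta(T) = m.  A relation rather than a function, since that some m is
   reachable at all (true from five vertices on) is not evident. *)
Definition decomposability_index (T : tournament) (m : nat) : Prop :=
  indec_after T m /\ forall k, indec_after T k -> m <= k.

End Tournaments.

(* delta(n) = m: delta(T) is defined and at most m for every tournament T on n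
   vertices, and the value m is attained. *)
Definition max_decomposability_index (n m : nat) : Prop :=
  (exists (V : finType) (T : tournament V),
      #|V| = n /\ decomposability_index T m) /\
  (forall (V : finType) (T : tournament V), #|V| = n ->
      exists k, decomposability_index T k /\ k <= m).

Definition ceil_div (m d : nat) : nat := (m + d.-1) %/ d.

Lemma ceil_div_leq m d q : 0 < d -> (ceil_div m d <= q) = (m <= q * d).
Proof.
case: d => // d _; rewrite /ceil_div -ltnS ltn_divLR // mulSn /=.
by rewrite addnC addSn ltnS leq_add2l.
Qed.

(* Main.v *)
(** Call a set of vertices a comodule if it or its complement is a nontrivial module, and
    let S be a set of vertices meeting every comodule; the tournament is indecomposable
    when S can be empty.

    Upper bound.  Two minimal comodules that meet are two-element modules, whose vertices
    have out-degrees of opposite parity.  Hence the vertices can be coloured so that every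
    minimal comodule with at least two vertices gets both colours; as at most two
    comodules are singletons, one of the colour classes extends to an S with
    2|S| <= n + 2.

    Let S be minimal and reverse the arc between x and y in S.  A new comodule separates x
    from y.  If it meets S in x only, it is a module of the new tournament, and its union
    with any module of the old one that meets S in y only is a module of the old one.  So
    S minus {x, y} meets every comodule of the new tournament unless some old comodule
    meets S in {x, y}, and among four vertices of S the three splits into pairs cannot all
    be cut out by comodules.  Thus one reversal saves two elements while |S| >= 4.  For
    smaller S compare the new modules N1 and N2 obtained at a fixed x by reversing its arc
    to y1 or to y2: either y2 lies in N1 or y1 lies in N2.  If |S| = 3 this lets one
    reversal remove x from S.  If |S| = 2 and reversing the arc inside S fails, then there
    is a single comodule up to complementation, it has at most two vertices, and the
    reversals between it and the outside cannot all fail on five or more vertices.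

    Lower bound.  In a transitive tournament the reversed arcs must touch both extreme
    vertices and one vertex of each consecutive pair. *)

Require Import Defs.
From mathcomp Require Import all_boot.
From mathcomp Require Import zify.

Set Implicit Arguments.
Unset Strict Implicit.
Unset Printing Implicit Defensive.

(** * Finite sets *)

Section FiniteSets.

Variable T : finType.
Implicit Types (A B C S : {set T}) (x y s : T).

Lemma mem_notin_neq A x y : x \in A -> y \notin A -> x != y.
Proof. by move=> xA /memPn; apply. Qed.

Lemma notin_mem_neq A x y : x \notin A -> y \in A -> x != y.
Proof. by move=> xA yA; rewrite eq_sym (mem_notin_neq yA). Qed.

Lemma ltn_card_exists A B : #|B| < #|A| -> exists2 x, x \in A & x \notin B.
Proof.
by move=> ltBA; apply/subsetPn; apply: contraL ltBA => /subset_leq_card; rewrite leqNgt.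
Qed.

Lemma exists_neq A x : 1 < #|A| -> exists2 y, y \in A & y != x.
Proof.
move=> gt1A; have [|y yA] := @ltn_card_exists A [set x]; first by rewrite cards1.
by rewrite inE; exists y.
Qed.

Lemma exists_neq2 A x y : 2 < #|A| -> exists w, [/\ w \in A, w != x & w != y].
Proof.
move=> gt2A; have [|w wA] := @ltn_card_exists A [set x; y].
  by rewrite cards2; case: eqP; lia.
by rewrite !inE negb_or => /andP[]; exists w.
Qed.

Lemma eq_set1 A x : x \in A -> (forall u, u \in A -> u = x) -> A = [set x].
Proof. by move=> xA onlyx; apply/setP=> u; rewrite inE; apply/idP/eqP=> [/onlyx|->]. Qed.

Lemma card_le1_set1 A x : x \in A -> #|A| <= 1 -> A = [set x].
Proof. by move=> xA le1A; apply: eq_set1 => // u uA; apply: (card_le1_eqP le1A). Qed.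

Lemma setI_eq1P C S x : C :&: S = [set x] <->
  [/\ x \in C, x \in S & forall s, s \in S -> s \in C -> s = x].
Proof.
split=> [trC|[xC xS onlyx]].
  have /setIP[xC xS] : x \in C :&: S by rewrite trC set11.
  by split=> // s sS sC; apply/set1P; rewrite -trC inE sC.
apply/setP=> s; rewrite !inE; apply/andP/eqP => [[sC sS]|-> //]; exact: onlyx.
Qed.

Lemma setI_eq1_notin C S x s : C :&: S = [set x] -> s \in S -> s != x -> s \notin C.
Proof. by case/setI_eq1P=> _ _ onlyx sS; apply: contra => sC; apply/eqP/onlyx. Qed.

Lemma setI_eq2 C S x y : x \in S -> y \in S -> x \in C -> y \in C ->
  (forall s, s \in S -> s \in C -> s = x \/ s = y) -> C :&: S = [set x; y].
Proof.
move=> xS yS xC yC onlyxy; apply/setP=> s; apply/setIP/set2P => [[sC sS]|].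
  exact: onlyxy.
by case=> ->.
Qed.

Lemma setI_eq2_split C S p q r s : C :&: S = [set p; q] ->
  r \in S -> s \in S -> [&& r != p, r != q, s != p & s != q] ->
  [&& p \in C, q \in C, r \notin C & s \notin C].
Proof.
move=> trC rS sS /and4P[rp rq sp sq].
have /setIP[pC _] : p \in C :&: S by rewrite trC set21.
have /setIP[qC _] : q \in C :&: S by rewrite trC set22.
have notin v : v \in S -> v != p -> v != q -> v \notin C.
  move=> vS vp vq; have := in_set2 v p q.
  by rewrite -trC inE vS andbT (negbTE vp) (negbTE vq) => ->.
by rewrite pC qC !notin.
Qed.

(* Every pair in [A] is an edge of the graph of [f], so [A] has at most [#|A|] pairs. *)
Lemma card_le3_chooses A (f : T -> T) :
  {in A &, forall x y, x != y -> f x = y \/ f y = x} -> #|A| <= 3.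
Proof.
move=> chooses; rewrite leqNgt; apply/negP=> gt3A.
have [x xA] : exists x, x \in A by apply/card_gt0P; lia.
have : 1 < #|A :\: [set x; f x]|.
  have := cardsID [set x; f x] A; have := subset_leq_card (subsetIr A [set x; f x]).
  by rewrite cards2; case: eqP; lia.
case/card_gt1P=> y [z [/setDP[yA yx] /setDP[zA zx] neq_yz]].
have chooses_x u : u \in A -> u \notin [set x; f x] -> f u = x.
  move=> uA; rewrite !inE negb_or => /andP[ux ufx].
  by have [|//|/eqP] := chooses u x uA xA; rewrite // eq_sym (negbTE ufx).
move: yx zx (chooses_x y yA yx) (chooses_x z zA zx).
rewrite !inE !negb_or => /andP[yx _] /andP[zx _] fy fz.
have [|] := chooses y z yA zA neq_yz; rewrite ?fy ?fz => def_x.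
  by rewrite def_x eqxx in zx.
by rewrite def_x eqxx in yx.
Qed.

End FiniteSets.

Arguments setI_eq1P {T C S x}.

(** * Modules and comodules of a tournament relation *)

Section Modules.

Variables (V : finType) (t : rel V).
Implicit Types (A B C K M S : {set V}) (u v w x y z : V).

Definition tournament_rel : Prop :=
  irreflexive t /\ forall x y, x != y -> t y x = ~~ t x y.

Definition module M : bool :=
  [forall x in M, forall y in M, forall v in ~: M, t v x == t v y].

Definition nontrivial_module M : bool := [&& module M, 1 < #|M| & M != setT].

Definition comodule C : bool := nontrivial_module C || nontrivial_module (~: C).

(* Singletons are modules, so the one-element modular comodules are the sources and the
   sinks. *)
Definition modular_comodule C : bool := comodule C && module C.

Definition private_comodule S x C : bool := comodule C && (C :&: S == [set x]).

Definition hitting S : bool := [forall C, comodule C ==> (S :&: C != set0)].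

Lemma moduleP M : reflect
  (forall x y v, x \in M -> y \in M -> v \notin M -> t v x = t v y) (module M).
Proof.
apply: (iffP idP) => [modM x y v xM yM vM | inout].
  move/forall_inP/(_ x xM)/forall_inP/(_ y yM)/forall_inP/(_ v): modM.
  by rewrite inE => /(_ vM)/eqP.
apply/forall_inP=> x xM; apply/forall_inP=> y yM; apply/forall_inP=> v.
by rewrite inE => vM; apply/eqP/inout.
Qed.

Lemma module_in M x y v :
  module M -> x \in M -> y \in M -> v \notin M -> t v x = t v y.
Proof. by move/moduleP; apply. Qed.

Lemma module_set1 x : module [set x].
Proof. by apply/moduleP=> u v w /set1P-> /set1P->. Qed.

Lemma module_const M (f : V -> bool) :
  (forall u v, u \in M -> v \notin M -> t v u = f v) -> module M.
Proof. by move=> tf; apply/moduleP=> x y v xM yM vM; rewrite !tf. Qed.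

Lemma moduleI A B : module A -> module B -> module (A :&: B).
Proof.
move=> modA modB; apply/moduleP=> x y v /setIP[xA xB] /setIP[yA yB].
rewrite inE negb_and => /orP[vA|vB]; first exact: module_in modA _ _ vA.
exact: module_in modB _ _ vB.
Qed.

Lemma moduleU A B x : x \in A -> x \in B -> module A -> module B -> module (A :|: B).
Proof.
move=> xA xB modA modB; apply: (module_const (f := t^~ x)) => u v uU.
rewrite inE negb_or => /andP[vA vB].
by case/setUP: uU => ?; [apply: module_in modA _ _ _ | apply: module_in modB _ _ _].
Qed.

Lemma nontrivial_moduleU A B x v : nontrivial_module A -> nontrivial_module B ->
  x \in A -> x \in B -> v \notin A :|: B -> nontrivial_module (A :|: B).
Proof.
case/and3P=> modA gt1A _ /and3P[modB _ _] xA xB vAB; apply/and3P; split.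
- exact: moduleU xA xB modA modB.
- exact: leq_trans gt1A (subset_leq_card (subsetUl _ _)).
- by apply: contraNneq vAB => ->.
Qed.

Lemma comoduleC C : comodule (~: C) = comodule C.
Proof. by rewrite /comodule setCK orbC. Qed.

Lemma comodule_neq0 C : comodule C -> exists x, x \in C.
Proof.
move=> comC; apply/set0Pn; case/orP: comC => /and3P[_ gt1 neqT].
  by rewrite -card_gt0; lia.
by apply: contraNneq neqT => ->; rewrite setC0.
Qed.

Lemma module_comodule M x y v :
  module M -> x \in M -> y \in M -> x != y -> v \notin M -> modular_comodule M.
Proof.
move=> modM xM yM neq_xy vM; apply/andP; split=> //.
apply/orP; left; apply/and3P; split=> //; first by apply/card_gt1P; exists x, y.
by apply: contraNneq vM => ->.
Qed.

Lemma comodule_modular C : comodule C -> modular_comodule C || modular_comodule (~: C).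
Proof.
move=> comC; rewrite /modular_comodule comoduleC comC /=.
by case/orP: comC => /and3P[-> //]; rewrite orbT.
Qed.

Lemma comodule_set1 v x y : comodule [set v] -> x != v -> y != v -> t v x = t v y.
Proof.
case/orP=> /and3P[modC gt1 _]; first by rewrite cards1 in gt1.
by move=> xv yv; apply: (module_in modC); rewrite !inE ?negbK.
Qed.

Lemma hittingP S :
  reflect (forall C, comodule C -> exists2 x, x \in S & x \in C) (hitting S).
Proof.
apply: (iffP idP) => [hitS C comC | meets].
  by move/forallP/(_ C)/implyP/(_ comC)/set0Pn: hitS => [x /setIP[]]; exists x.
apply/forallP=> C; apply/implyP=> /meets[x xS xC].
by apply/set0Pn; exists x; rewrite inE xS.
Qed.

Lemma hitting_notin S C : hitting S -> comodule C -> exists2 x, x \in S & x \notin C.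
Proof.
by rewrite -comoduleC => /hittingP hitS /hitS[x xS]; rewrite inE; exists x.
Qed.

Lemma not_hitting S :
  ~~ hitting S -> exists2 C, comodule C & forall s, s \in S -> s \notin C.
Proof.
rewrite negb_forall => /existsP[C]; rewrite negb_imply negbK setI_eq0 => /andP[comC disj].
by exists C => // s sS; rewrite (disjointFr disj).
Qed.

Lemma hitting_disjoint_module S M : hitting S -> S != set0 -> module M ->
  (forall s, s \in S -> s \notin M) -> #|M| <= 1.
Proof.
move=> /hittingP hitS /set0Pn[s sS] modM disj; rewrite leqNgt; apply/negP.
case/card_gt1P=> x [y [xM yM neq_xy]].
by have /andP[/hitS[u /disj/negP]] := module_comodule modM xM yM neq_xy (disj s sS).
Qed.

Lemma hitting_sub_module S M :
  hitting S -> 1 < #|S| -> module M -> S \subset M -> M = setT.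
Proof.
move=> hitS /card_gt1P[x [y [xS yS neq_xy]]] modM /subsetP sSM.
apply/setP=> v; rewrite inE; apply: contraT => vM.
have /andP[comM _] := module_comodule modM (sSM x xS) (sSM y yS) neq_xy vM.
by have [u /sSM ->] := hitting_notin hitS comM.
Qed.

Lemma hitting2P x y :
  reflect (forall C, comodule C -> (x \in C) = (y \notin C)) (hitting [set x; y]).
Proof.
apply: (iffP idP) => [hitxy C comC | sep].
  have [r /set2P r_xy] := hitting_notin hitxy comC.
  have [s /set2P s_xy] := hittingP _ hitxy C comC.
  by case: r_xy s_xy => -> [] ->; case: (x \in C); case: (y \in C).
apply/hittingP=> C /sep; case: (boolP (y \in C)) => yC xC.
  by exists y; rewrite ?set22.
by exists x; rewrite ?set21 ?xC.
Qed.

Lemma minset_hitting_private S x : minset hitting S -> x \in S ->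
  exists C, private_comodule S x C.
Proof.
case/minsetP=> hitS minS xS.
have [|C comC avoids] := @not_hitting (S :\ x).
  apply/negP=> /minS/(_ (subsetDl _ _))/setP/(_ x).
  by rewrite !inE eqxx xS.
have onlyx s : s \in S -> s \in C -> s = x.
  by move=> sS; apply: contraTeq => sx; apply: avoids; rewrite !inE sx.
exists C; rewrite /private_comodule comC; apply/eqP/setI_eq1P; split=> //.
by have [s sS sC] := hittingP _ hitS C comC; rewrite -(onlyx s).
Qed.

Lemma minset_hitting_neq1 S : minset hitting S -> #|S| != 1.
Proof.
move=> minS; apply/negP=> /cards1P[x defS].
have xS : x \in S by rewrite defS set11.
have [C /andP[comC /eqP/setI_eq1P[xC _ _]]] := minset_hitting_private minS xS.
by have [s] := hitting_notin (minsetp minS) comC; rewrite defS => /set1P->; rewrite xC.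
Qed.

Section Tournament.

Hypothesis tourn : tournament_rel.

Lemma tournament_swap x y : x != y -> t y x = ~~ t x y.
Proof. by case: tourn => _; apply. Qed.

Lemma module_out M x y v :
  module M -> x \in M -> y \in M -> v \notin M -> t x v = t y v.
Proof.
move=> modM xM yM vM; rewrite !(@tournament_swap v) ?(notin_mem_neq vM) //.
by rewrite (module_in modM xM yM vM).
Qed.

Lemma moduleD A B z : z \in B -> z \notin A -> module A -> module B -> module (A :\: B).
Proof.
move=> zB zA modA modB; apply/moduleP=> x y v /setDP[xA xB] /setDP[yA yB] vD.
have [vA|vA] := boolP (v \in A); last exact: module_in modA _ _ vA.
have vB : v \in B by move: vD; rewrite inE vA andbT negbK.
by rewrite !(module_out modB vB zB) // (module_in modA xA yA zA).
Qed.

Lemma moduleD1 M x b : module M -> x \in M ->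
  (forall u, u \in M -> u != x -> t x u = b) -> module (M :\ x).
Proof.
move=> modM xM txb; apply/moduleP=> u v w /setD1P[ux uM] /setD1P[vx vM].
rewrite in_setD1 negb_and negbK => /orP[/eqP->|wM]; first by rewrite !txb.
exact: module_in modM _ _ wM.
Qed.

End Tournament.

End Modules.

Arguments moduleP {V t M}.
Arguments hittingP {V t S}.
Arguments hitting2P {V t x y}.

Lemma eq_module (V : finType) (t t' : rel V) M : t =2 t' -> module t M = module t' M.
Proof.
move=> eq_t; apply: eq_forallb_in => x _; apply: eq_forallb_in => y _.
by apply: eq_forallb_in => v _; rewrite !eq_t.
Qed.

Lemma eq_comodule (V : finType) (t t' : rel V) C :
  t =2 t' -> comodule t C = comodule t' C.
Proof. by move=> eq_t; rewrite /comodule /nontrivial_module !(eq_module _ eq_t). Qed.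

Lemma eq_hitting (V : finType) (t t' : rel V) S : t =2 t' -> hitting t S = hitting t' S.
Proof. by move=> eq_t; apply: eq_forallb => C; rewrite (eq_comodule _ eq_t). Qed.

(** * Reversing one arc *)

Definition flip (V : finType) (t : rel V) (x y : V) : rel V :=
  fun u v => t u v (+) ((u == x) && (v == y) || (u == y) && (v == x)).

Definition split_module (V : finType) (t : rel V) (x y : V) (N : {set V}) : bool :=
  [&& module (flip t x y) N, x \in N & y \notin N].

Definition split_comodule (V : finType) (t : rel V) (x y : V) (N : {set V}) : bool :=
  comodule (flip t x y) N && split_module t x y N.

Section Flip.

Variables (V : finType) (t : rel V).
Implicit Types (C K M N S : {set V}) (u v w x y z : V).

Lemma flipC x y : flip t x y =2 flip t y x.
Proof. by move=> u v; rewrite /flip orbC. Qed.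

Lemma flip_off x y u v : u != x -> u != y -> flip t x y u v = t u v.
Proof. by move=> /negbTE ux /negbTE uy; rewrite /flip ux uy addbF. Qed.

Lemma flip_end x y v : x != y -> flip t x y x v = t x v (+) (v == y).
Proof. by move=> /negbTE neq_xy; rewrite /flip eqxx neq_xy orbF. Qed.

Lemma flip_module x y N : (x \in N) = (y \in N) -> module (flip t x y) N = module t N.
Proof.
move=> eq_xy; have flipE u v : u \in N -> v \notin N -> flip t x y v u = t v u.
  move=> uN vN; rewrite /flip -[RHS]addbF; congr (_ (+) _); apply/negP.
  case/orP=> /andP[/eqP def_v /eqP def_u]; move: eq_xy;
    by rewrite -def_v -def_u uN (negbTE vN).
apply/moduleP/moduleP=> modN u v w uN vN wN; have := modN u v w uN vN wN.
  by rewrite !flipE.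
by rewrite !flipE.
Qed.

Lemma flip_comodule x y C :
  (x \in C) = (y \in C) -> comodule (flip t x y) C = comodule t C.
Proof.
by move=> eq_xy; rewrite /comodule /nontrivial_module !flip_module // !inE eq_xy.
Qed.

Hypothesis tourn : tournament_rel t.

Lemma flip_tournament x y : x != y -> tournament_rel (flip t x y).
Proof.
move=> /negbTE neq_xy; split=> [u|u v neq_uv]; rewrite /flip.
  rewrite tourn.1 addFb [in X in _ || X]andbC orbb.
  by apply/negbTE/nandP; case: (eqVneq u x) => [->|_]; [right; rewrite neq_xy | left].
rewrite (tournament_swap tourn neq_uv) addNb orbC; congr (~~ (_ (+) _)).
by rewrite ![_ && (u == _)]andbC.
Qed.

(** * Modules of the reversed relation that separate the two ends *)

Section SplitModule.

Variables (x y : V) (N : {set V}).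
Hypothesis splitN : split_module t x y N.

Lemma split_neq : x != y.
Proof. by case/and3P: splitN => _; apply: mem_notin_neq. Qed.

Lemma split_in u v w : u \in N -> v \in N -> w \notin N -> w != y -> t w u = t w v.
Proof.
case/and3P: splitN => modN xN yN uN vN wN wy.
have wx : w != x by apply: notin_mem_neq xN.
by rewrite -!(flip_off _ wx wy) (module_in modN uN vN wN).
Qed.

Lemma split_out u v w : u \in N -> v \in N -> w \notin N -> w != y -> t u w = t v w.
Proof.
move=> uN vN wN wy; rewrite !(@tournament_swap _ _ tourn w) ?(notin_mem_neq wN) //.
by rewrite (split_in uN vN).
Qed.

Lemma split_end u : u \in N -> u != x -> t y u = ~~ t y x.
Proof.
case/and3P: splitN => modN xN yN uN ux.
have := module_in modN uN xN yN; rewrite !(flipC x y) !flip_end ?(eq_sym y) ?split_neq //.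
by rewrite (negbTE ux) eqxx addbF addbT.
Qed.

Lemma split_end_out u : u \in N -> u != x -> t u y = ~~ t x y.
Proof.
case/and3P: splitN => _ xN yN uN ux.
by rewrite !(@tournament_swap _ _ tourn y) ?(notin_mem_neq yN) // split_end.
Qed.

End SplitModule.

Lemma flip_comodule_split x y C : comodule (flip t x y) C -> x \in C -> y \notin C ->
  split_module t x y C || split_module t y x (~: C).
Proof.
move=> comC xC yC; rewrite /split_module !inE xC yC !andbT /=.
have /orP[/andP[_ ->]|/andP[_ modC]] := comodule_modular comC; first by [].
by rewrite (eq_module _ (flipC y x)) modC orbT.
Qed.

Lemma split_moduleI_eq x y N K u : split_module t x y N -> module t K ->
  x \in K -> y \notin K -> u \in N -> u \in K -> u = x.
Proof.
move=> splitN modK xK yK uN uK; apply/eqP; apply: contraT => ux.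
have := split_end splitN uN ux; rewrite (module_in modK uK xK yK).
by case: (t y x).
Qed.

Lemma split_arc x y N K k z : split_module t x y N -> module t K ->
  x \in K -> y \notin K -> k \in K -> k != x -> z \in N -> z != x -> t k x = t x z.
Proof.
move=> splitN modK xK yK kK kx zN zx; have [_ xN _] := and3P splitN.
have only_x u := split_moduleI_eq splitN modK xK yK (u := u).
have kN : k \notin N by apply: contra kx => kN; apply/eqP/only_x.
have zK : z \notin K by apply: contra zx => zK; apply/eqP/only_x.
rewrite (split_in splitN xN zN kN (mem_notin_neq kK yK)).
exact: (module_out tourn modK kK xK zK).
Qed.

Lemma split_arc_agree x y1 y2 N1 N2 K z1 z2 :
  split_module t x y1 N1 -> split_module t x y2 N2 -> modular_comodule t K ->
  x \in K -> y1 \notin K -> y2 \notin K ->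
  z1 \in N1 -> z1 != x -> z2 \in N2 -> z2 != x -> t x z1 = t x z2.
Proof.
move=> split1 split2 /andP[comK modK] xK y1K y2K z1N z1x z2N z2x.
have [gt1K|le1K] := ltnP 1 #|K|.
  have [k kK kx] := exists_neq x gt1K.
  rewrite -(split_arc split1 modK xK y1K kK kx z1N z1x).
  exact: split_arc split2 modK xK y2K kK kx z2N z2x.
by rewrite (card_le1_set1 xK le1K) in comK; apply: (comodule_set1 comK).
Qed.

Lemma split_moduleD1 x y N K : split_module t x y N -> modular_comodule t K ->
  x \in K -> y \notin K -> module t (N :\ x).
Proof.
move=> splitN comK xK yK; have [modN xN yN] := and3P splitN.
have neq_xy := split_neq splitN.
rewrite -(@flip_module x y) ?in_setD1 ?eqxx ?(negbTE yN) ?andbF //.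
have [->|[z /setD1P[zx zN]]] := set_0Vmem (N :\ x).
  by apply/moduleP=> u; rewrite inE.
apply: (moduleD1 (b := t x z)) => // u uN ux; rewrite flip_end //.
rewrite (negbTE (mem_notin_neq uN yN)) addbF.
by apply: (split_arc_agree splitN splitN comK).
Qed.

Lemma moduleD1_split x y N K : split_module t x y N -> 1 < #|N| -> module t K ->
  x \in K -> y \notin K -> module t (K :\ x).
Proof.
move=> splitN gt1N modK xK yK; have [z zN zx] := exists_neq x gt1N.
apply: (moduleD1 (b := ~~ t x z)) => // k kK kx.
by rewrite (tournament_swap tourn kx) (split_arc splitN modK xK yK kK kx zN zx).
Qed.

Lemma split_cross x y N K u v : split_module t x y N -> module t K ->
  y \in K -> x \notin K -> u \in K :\: N -> v \in N :\: K -> u = y \/ v = x.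
Proof.
move=> splitN modK yK xK /setDP[uK uN] /setDP[vN vK]; have [_ xN _] := and3P splitN.
have [->|uy] := eqVneq u y; first by left.
have [->|vx] := eqVneq v x; first by right.
have := split_end_out splitN vN vx; rewrite (module_in modK yK uK vK).
rewrite (module_in modK yK uK xK).
by rewrite (split_out splitN vN xN uN uy); case: (t x u).
Qed.

Lemma split_moduleU x y N K z : split_module t x y N -> module t K ->
  y \in K -> z \in N -> z \in K -> module t (N :|: K).
Proof.
move=> splitN modK yK zN zK; apply: (module_const (f := t^~ z)) => u v uU.
rewrite inE negb_or => /andP[vN vK]; case/setUP: uU => [uN|uK].
  by apply: (split_in splitN) => //; apply: notin_mem_neq yK.
exact: module_in modK _ _ vK.
Qed.

Lemma flip_comodule_set1 x y v : x != y -> comodule (flip t x y) [set x] ->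
  v != x -> v != y -> t x v = ~~ t x y.
Proof.
move=> neq_xy comx vx vy; have yx : y != x by rewrite eq_sym.
have := comodule_set1 comx vx yx.
by rewrite !flip_end // (negbTE vy) eqxx addbF addbT.
Qed.

Lemma flip_comodule_set1_module x y :
  x != y -> comodule (flip t x y) [set x] -> comodule t [set y] ->
  module t [set x; y].
Proof.
move=> neq_xy comx comy; apply: (module_const (f := t^~ y)) => u v /set2P[]-> //.
rewrite !inE negb_or => /andP[vx vy].
rewrite (tournament_swap tourn (x := x)) 1?(tournament_swap tourn (x := y)) 1?eq_sym //.
rewrite (flip_comodule_set1 neq_xy) // (comodule_set1 (y := x) comy) //.
by rewrite (tournament_swap tourn neq_xy).
Qed.

Lemma split_comodule_disjoint x y N K : split_comodule t x y N -> modular_comodule t K ->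
  y \in K -> (forall z, z \in N -> z \notin K) ->
  N = [set x] /\ K = [set y].
Proof.
move=> /andP[comN splitN] /andP[comK modK] yK notin_K; have [_ xN yN] := and3P splitN.
have neq_xy := split_neq splitN.
have xK := notin_K x xN.
have notin_N u : u \in K -> u \notin N by apply: contraTN => /notin_K.
have cross u v : u \in K -> v \in N -> u = y \/ v = x.
  move=> uK vN; apply: (split_cross splitN modK yK xK); rewrite inE.
    by rewrite uK notin_N.
  by rewrite vN notin_K.
have defN : N = [set x].
  apply: eq_set1 => // v vN; apply/eqP; apply: contraT => vx.
  have defK : K = [set y].
    by apply: eq_set1 => // u uK; have [|/eqP] := cross u v uK vN; rewrite ?(negbTE vx).
  have := split_end splitN vN vx; rewrite defK in comK.
  by rewrite (comodule_set1 comK (mem_notin_neq vN yN) neq_xy); case: (t y x).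
split=> //; apply: eq_set1 => // u uK; apply/eqP; apply: contraT => uy.
rewrite defN in comN; have := flip_comodule_set1 neq_xy comN (mem_notin_neq uK xK) uy.
by rewrite (module_in modK uK yK xK); case: (t x y).
Qed.

Lemma split_comoduleU x y N K : split_comodule t x y N -> modular_comodule t K ->
  y \in K -> x \notin K -> module t (N :|: K).
Proof.
move=> splitN' comK yK xK; have [comN splitN] := andP splitN'.
have [disj|[z /setIP[zN zK]]] := set_0Vmem (N :&: K).
  have [|defN defK] := split_comodule_disjoint splitN' comK yK.
    by move=> z zN; apply/negP=> zK; have := in_set0 z; rewrite -disj inE zN zK.
  rewrite defN in comN *; rewrite defK in comK *; have [comy _] := andP comK.
  exact: flip_comodule_set1_module (split_neq splitN) comN comy.
by case/andP: comK => _ modK; apply: (split_moduleU splitN modK yK zN zK).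
Qed.

Lemma split_comodule_setC1 x y N K S w : split_comodule t x y N ->
  modular_comodule t K -> y \in K -> x \notin K -> hitting t S -> 1 < #|S| ->
  S \subset N :|: K -> w \notin K -> w != x -> N = ~: [set y].
Proof.
move=> splitN' comK yK xK hitS gt1S sS wK wx; have [_ splitN] := andP splitN'.
have [_ _ yN] := and3P splitN.
have full v : v \in N :|: K.
  by rewrite (hitting_sub_module hitS gt1S (split_comoduleU splitN' comK yK xK) sS).
have wN : w \in N by have := full w; rewrite inE (negbTE wK) orbF.
apply/eqP; rewrite eqEsubset; apply/andP; split; apply/subsetP=> u.
  by rewrite !inE => uN; apply: mem_notin_neq yN.
rewrite !inE => uy; apply: contraT => uN.
have uK : u \in K by have := full u; rewrite inE (negbTE uN).
case/andP: comK => _ modK.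
have [||/eqP|/eqP] := @split_cross x y N K u w splitN modK yK xK.
- by rewrite inE uK uN.
- by rewrite inE wN wK.
- by rewrite (negbTE uy).
- by rewrite (negbTE wx).
Qed.

Lemma split_set1_meet x y1 y2 N K :
  x != y1 -> comodule (flip t x y1) [set x] ->
  split_comodule t x y2 N -> modular_comodule t K ->
  x \in K -> y1 \notin K -> y2 \notin K -> y1 != y2 -> y1 \in N.
Proof.
move=> neq_xy1 comx /andP[comN splitN] comK xK y1K y2K neq_y.
have [_ xN _] := and3P splitN.
have [y1x y2x] : y1 != x /\ y2 != x by split; apply: notin_mem_neq xK.
have neq_y' : y2 != y1 by rewrite eq_sym.
have tx v : v != x -> v != y1 -> t x v = ~~ t x y1.
  by move=> vx vy1; apply: flip_comodule_set1.
apply: contraT => y1N; have [comK' modK] := andP comK.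
have [k kK kx] : exists2 k, k \in K & k != x.
  apply: exists_neq; rewrite ltnNge; apply/negP=> /(card_le1_set1 xK) defK.
  rewrite defK in comK'; have := comodule_set1 comK' y1x y2x.
  by rewrite (tx y2) //; case: (t x y1).
have ky1 := mem_notin_neq kK y1K; have xk : x != k by rewrite eq_sym.
have [le1N|gt1N] := leqP #|N| 1.
  rewrite (card_le1_set1 xN le1N) in comN.
  have := flip_comodule_set1 (split_neq splitN) comN kx (mem_notin_neq kK y2K).
  by rewrite (tx k) // (tx y2) //; case: (t x y1).
have [z zN zx] := exists_neq x gt1N; have := split_arc splitN modK xK y2K kK kx zN zx.
rewrite (tournament_swap tourn xk) (tx k) // (tx z) ?(mem_notin_neq zN y1N) //.
by case: (t x y1).
Qed.

Lemma split_modules_gt1_meet x y1 y2 N1 N2 K :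
  split_module t x y1 N1 -> 1 < #|N1| -> split_module t x y2 N2 -> 1 < #|N2| ->
  modular_comodule t K -> x \in K -> y1 \notin K -> y2 \notin K -> y1 != y2 ->
  (y2 \in N1) || (y1 \in N2).
Proof.
move=> split1 gt1N1 split2 gt1N2 comK xK y1K y2K neq_y.
have [[_ xN1 _] [_ xN2 _]] := (and3P split1, and3P split2).
have [z1 z1N z1x] := exists_neq x gt1N1; have [z2 z2N z2x] := exists_neq x gt1N2.
apply: contraT; rewrite negb_or => /andP[y2N1 y1N2].
have meet u : u \in N1 -> u \in N2 -> u = x.
  move=> uN1 uN2; apply/eqP; apply: contraT => ux.
  have := split_end split1 uN1 ux; rewrite (split_in split2 uN2 xN2 y1N2) //.
  by case: (t y1 x).
have z1N2 : z1 \notin N2 by apply: contra z1x => z1N2; apply/eqP/meet.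
have z2N1 : z2 \notin N1 by apply: contra z2x => z2N1; apply/eqP/meet.
have := split_arc_agree split1 split2 comK xK y1K y2K z1N z1x z2N z2x.
rewrite (split_out split1 xN1 z1N z2N1) ?(mem_notin_neq z2N y1N2) //.
rewrite (split_out split2 xN2 z2N z1N2) ?(mem_notin_neq z1N y2N1) //.
by rewrite (tournament_swap tourn (mem_notin_neq z1N z2N1)); case: (t z1 z2).
Qed.

Lemma split_comodules_meet x y1 y2 N1 N2 K :
  split_comodule t x y1 N1 -> split_comodule t x y2 N2 ->
  modular_comodule t K -> x \in K -> y1 \notin K -> y2 \notin K -> y1 != y2 ->
  (y2 \in N1) || (y1 \in N2).
Proof.
move=> split1' split2' comK xK y1K y2K neq_y.
have [[com1 split1] [com2 split2]] := (andP split1', andP split2').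
have [[_ xN1 _] [_ xN2 _]] := (and3P split1, and3P split2).
have neq_y' : y2 != y1 by rewrite eq_sym.
have [le1N1|gt1N1] := leqP #|N1| 1.
  rewrite (card_le1_set1 xN1 le1N1) in com1.
  by rewrite (split_set1_meet (split_neq split1) com1 split2' comK) ?orbT.
have [le1N2|gt1N2] := leqP #|N2| 1.
  rewrite (card_le1_set1 xN2 le1N2) in com2.
  by rewrite (split_set1_meet (split_neq split2) com2 split1' comK).
exact: split_modules_gt1_meet split1 gt1N1 split2 gt1N2 comK _ _ _ _.
Qed.

End Flip.

(** * Reversing an arc between two vertices of a hitting set *)

Section LargeHittingSets.

Variables (V : finType) (t : rel V).
Hypothesis tourn : tournament_rel t.
Implicit Types (A C D K N S : {set V}) (u v w x y z : V).

Definition has_modular_private S x : bool :=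
  [exists C, private_comodule t S x C && module t C].

Lemma has_modular_privateP S x :
  reflect (exists2 C, private_comodule t S x C & module t C) (has_modular_private S x).
Proof. by apply: (iffP existsP) => [[C /andP[]]|[C]]; exists C => //; apply/andP. Qed.

Lemma minset_hitting_modular_private S x y : minset (hitting t) S -> 2 < #|S| ->
  x \in S -> y \in S -> x != y -> has_modular_private S x || has_modular_private S y.
Proof.
move=> minS gt2S xS yS neq_xy; have hitS := minsetp minS.
have [C privC] := minset_hitting_private minS xS.
have [D privD] := minset_hitting_private minS yS.
have [[comC /eqP trC] [comD /eqP trD]] := (andP privC, andP privD).
have [/andP[_ modC]|/andP[_ modC']] := orP (comodule_modular comC).
  by apply/orP; left; apply/has_modular_privateP; exists C.
have [/andP[_ modD]|/andP[_ modD']] := orP (comodule_modular comD).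
  by apply/orP; right; apply/has_modular_privateP; exists D.
apply/orP; left; apply/has_modular_privateP; exists C => //.
have [[xC _ _] [yD _ _]] := (iffLR setI_eq1P trC, iffLR setI_eq1P trD).
have notinC s : s \in S -> s != x -> s \in ~: C by rewrite inE; apply: setI_eq1_notin.
have notinD s : s \in S -> s != y -> s \in ~: D by rewrite inE; apply: setI_eq1_notin.
have yx : y != x by rewrite eq_sym.
have [w [wS wx wy]] := exists_neq2 x y gt2S.
have full : ~: C :|: ~: D = setT.
  apply: (hitting_sub_module hitS (ltnW gt2S)).
    exact: moduleU (notinC w wS wx) (notinD w wS wy) modC' modD'.
  apply/subsetP=> s sS; rewrite in_setU; have [->|sx] := eqVneq s x.
    by rewrite notinD ?orbT.
  by rewrite notinC.
have -> : C = ~: D :\: ~: C.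
  apply/setP=> v; have := in_setT v; rewrite -full !inE negbK.
  by case: (v \in C); case: (v \in D).
by apply: (moduleD tourn (z := y)); rewrite ?notinC ?inE ?negbK.
Qed.

Lemma flip_private_split S K C x y : hitting t S -> 2 < #|S| -> y \in S -> x != y ->
  private_comodule t S x K -> private_comodule (flip t x y) S x C ->
  split_comodule t x y C.
Proof.
move=> hitS gt2S yS neq_xy /andP[comK /eqP trK] /andP[comC /eqP trC].
rewrite /split_comodule comC /=.
have [[xK _ _] [xC _ _]] := (iffLR setI_eq1P trK, iffLR setI_eq1P trC).
have notinK s := setI_eq1_notin trK (s := s).
have notinC s := setI_eq1_notin trC (s := s).
have yx : y != x by rewrite eq_sym.
have [w [wS wx wy]] := exists_neq2 x y gt2S.
have [//|splitC'] := orP (flip_comodule_split comC xC (notinC y yS yx)).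
have modK : modular_comodule t K.
  have [//|/andP[_ modK']] := orP (comodule_modular comK).
  have wC' : w \in ~: C by rewrite inE notinC.
  have := split_end splitC' wC' wy.
  rewrite (module_in modK' (y := y)) ?inE ?negbK ?notinK //.
  by case: (t x y).
have comC' : comodule (flip t y x) (~: C).
  by rewrite comoduleC -(eq_comodule _ (flipC t x y)).
have sS : S \subset ~: C :|: K.
  apply/subsetP=> s sS; rewrite !inE.
  by have [->|sx] := eqVneq s x; rewrite ?xK ?orbT // notinC.
have /setC_inj defC : ~: C = ~: [set x].
  apply: (split_comodule_setC1 tourn _ modK) (ltnW gt2S) sS _ wy; rewrite ?notinK //.
  exact/andP.
by rewrite /split_module defC module_set1 set11 inE.
Qed.

Lemma flip_private_pair S K L C x y : hitting t S -> 2 < #|S| -> x != y ->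
  private_comodule t S x K -> private_comodule t S y L -> module t L ->
  private_comodule (flip t x y) S x C ->
  exists2 D, comodule t D & D :&: S = [set x; y].
Proof.
move=> hitS gt2S neq_xy privK /andP[comL /eqP/setI_eq1P[yL yS onlyL]] modL privC.
have splitC := flip_private_split hitS gt2S yS neq_xy privK privC.
have [_ /eqP trC] := andP privC; have [xC xS onlyC] := iffLR setI_eq1P trC.
have xL : x \notin L by apply: contra neq_xy => /(onlyL x xS)->.
have only_xy s : s \in S -> s \in C :|: L -> s = x \/ s = y.
  by move=> sS /setUP[/(onlyC s sS)|/(onlyL s sS)]; [left | right].
have [xCL yCL] : x \in C :|: L /\ y \in C :|: L by rewrite !inE xC yL orbT.
have [w [wS wx wy]] := exists_neq2 x y gt2S.
exists (C :|: L); last exact: setI_eq2.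
have modCL : module t (C :|: L).
  by apply: (split_comoduleU tourn splitC _ yL xL); rewrite /modular_comodule comL.
have wCL : w \notin C :|: L.
  by apply/negP=> /(only_xy w wS)[]/eqP; rewrite ?(negbTE wx) ?(negbTE wy).
by have /andP[] := module_comodule modCL xCL yCL neq_xy wCL.
Qed.

Lemma hitting_flip_setD2 S x y : hitting t S -> 2 < #|S| ->
  x \in S -> y \in S -> x != y -> has_modular_private S x -> has_modular_private S y ->
  (forall C, comodule t C -> C :&: S != [set x; y]) ->
  hitting (flip t x y) (S :\: [set x; y]).
Proof.
move=> hitS gt2S xS yS neq_xy /has_modular_privateP[K privK modK].
move=> /has_modular_privateP[L privL modL] no_pair.
apply: contraT => /not_hitting[C comC avoids].
have only_xy s : s \in S -> s \in C -> s = x \/ s = y.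
  move=> sS sC; apply/set2P; apply: contraLR sC => sxy; apply: avoids.
  by rewrite inE sxy.
have [xC|xC] := boolP (x \in C); have [yC|yC] := boolP (y \in C).
- rewrite flip_comodule ?xC // in comC.
  by have /eqP[] := no_pair C comC; apply: setI_eq2.
- have privC : private_comodule (flip t x y) S x C.
    rewrite /private_comodule comC; apply/eqP/setI_eq1P.
    split=> // s sS sC; have [//|sy] := only_xy s sS sC.
    by rewrite -sy sC in yC.
  have [D comD trD] := flip_private_pair hitS gt2S neq_xy privK privL modL privC.
  by have := no_pair D comD; rewrite trD eqxx.
- have privC : private_comodule (flip t y x) S y C.
    rewrite /private_comodule -(eq_comodule _ (flipC t x y)) comC; apply/eqP/setI_eq1P.
    split=> // s sS sC; have [sx|//] := only_xy s sS sC.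
    by rewrite -sx sC in xC.
  have yx : y != x by rewrite eq_sym.
  have [D comD trD] := flip_private_pair hitS gt2S yx privL privK modK privC.
  by have := no_pair D comD; rewrite trD setUC eqxx.
- rewrite flip_comodule ?(negbTE xC) ?(negbTE yC) // in comC.
  have [s sS sC] := hittingP hitS C comC.
  by have [def_s|def_s] := only_xy s sS sC; rewrite def_s ?(negbTE xC) ?(negbTE yC) in sC.
Qed.

(* Only four vertices matter: no tournament on them has each of its three balanced splits
   given by a module on one of the two sides. *)
Lemma comodules_balanced_splits a b c d C1 C2 C3 :
  comodule t C1 -> comodule t C2 -> comodule t C3 ->
  [&& a \in C1, b \in C1, c \notin C1 & d \notin C1] ->
  [&& b \in C2, c \in C2, a \notin C2 & d \notin C2] ->
  [&& a \in C3, c \in C3, b \notin C3 & d \notin C3] -> False.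
Proof.
have split_arcs C p q r s :
    comodule t C -> [&& p \in C, q \in C, r \notin C & s \notin C] ->
    (t r p = t r q /\ t s p = t s q) \/ (t p r = t p s /\ t q r = t q s).
  move=> comC /and4P[pC qC rC sC]; case/orP: comC => /and3P[modC _ _]; [left|right].
    by split; apply: (module_in modC).
  by split; apply: (module_in modC); rewrite ?inE ?negbK.
move=> com1 com2 com3 in1 in2 in3.
have := split_arcs C1 _ _ _ _ com1 in1; have := split_arcs C2 _ _ _ _ com2 in2.
have := split_arcs C3 _ _ _ _ com3 in3.
case/and4P: in1 in2 in3 => a1 b1 c1 d1 /and4P[b2 c2 a2 d2] /and4P[a3 c3 b3 d3].
have sym u v C : u \in C -> v \notin C -> t v u = ~~ t u v.
  by move=> uC vC; apply: (tournament_swap tourn (mem_notin_neq uC vC)).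
rewrite (sym a c C1) // (sym a d C1) // (sym b d C1) // (sym c d C2) //.
rewrite (sym b c C1) // (sym a b C3) //.
case: (t a b); case: (t a c); case: (t a d); case: (t b c); case: (t b d); case: (t c d);
  by move=> [[? ?]|[? ?]] [[? ?]|[? ?]] [[? ?]|[? ?]].
Qed.

Lemma exists_pair_no_trace S A : A \subset S -> 2 < #|A| -> 3 < #|S| ->
  exists x y, [/\ x \in A, y \in A, x != y &
    forall C, comodule t C -> C :&: S != [set x; y]].
Proof.
move=> /subsetP sAS /card_gt2P[a [b [c [[aA bA cA] [ab bc ca]]]]] gt3S.
have [ba cb ac] : [/\ b != a, c != b & a != c] by split; rewrite eq_sym.
have [d dS] : exists2 d, d \in S & d \notin [set a; b; c].
  by apply: ltn_card_exists; rewrite cardsU cards1 cards2 ab; lia.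
rewrite !inE !negb_or => /andP[/andP[da db] dc].
pose is_trace x y := [exists C, comodule t C && (C :&: S == [set x; y])].
have not_trace x y : ~~ is_trace x y -> forall C, comodule t C -> C :&: S != [set x; y].
  by rewrite negb_exists => /forallP no_C C comC; have := no_C C; rewrite comC.
have [/existsP[C1 /andP[com1 /eqP tr1]]|/not_trace] := boolP (is_trace a b);
  last by exists a, b.
have [/existsP[C2 /andP[com2 /eqP tr2]]|/not_trace] := boolP (is_trace b c);
  last by exists b, c.
have [/existsP[C3 /andP[com3 /eqP tr3]]|/not_trace] := boolP (is_trace a c);
  last by exists a, c.
have [aS bS cS] := And3 (sAS a aA) (sAS b bA) (sAS c cA).
case: (@comodules_balanced_splits a b c d C1 C2 C3) => //.
- by apply: setI_eq2_split tr1 cS dS _; apply/and4P.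
- by apply: setI_eq2_split tr2 aS dS _; apply/and4P.
- by apply: setI_eq2_split tr3 bS dS _; apply/and4P.
Qed.

Lemma card_modular_private S : minset (hitting t) S -> 2 < #|S| ->
  #|S| <= #|[set x in S | has_modular_private S x]|.+1.
Proof.
move=> minS gt2S; rewrite -(cardsID [set x in S | has_modular_private S x] S) -addn1.
apply: leq_add; first by apply/subset_leq_card/subsetIr.
apply/card_le1_eqP=> x y /setDP[xS]; rewrite inE xS /= => not_x /setDP[yS].
rewrite inE yS /= => not_y; apply/eqP; apply: contraT; rewrite eq_sym => neq_xy.
have := minset_hitting_modular_private minS gt2S xS yS neq_xy.
by rewrite (negbTE not_x) (negbTE not_y).
Qed.

Lemma minset_hitting_flip_setD2 S : minset (hitting t) S -> 3 < #|S| ->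
  exists x y, [/\ x \in S, y \in S, x != y & hitting (flip t x y) (S :\: [set x; y])].
Proof.
move=> minS gt3S; have gt2S := ltnW gt3S.
have [||x [y]] := @exists_pair_no_trace S [set x in S | has_modular_private S x] _ _ gt3S.
- by apply/subsetP=> x; rewrite inE => /andP[].
- by have := card_modular_private minS gt2S; lia.
rewrite !inE => -[/andP[xS privx] /andP[yS privy] neq_xy no_pair].
by exists x, y; split=> //; apply: hitting_flip_setD2 => //; apply: minsetp minS.
Qed.

Lemma not_hitting_flip_setD1 S x y : hitting t S -> x \in S -> y \in S -> x != y ->
  ~~ hitting (flip t x y) (S :\ x) ->
  exists C, private_comodule (flip t x y) S x C.
Proof.
move=> hitS xS yS neq_xy /not_hitting[C comC avoids]; exists C.
rewrite /private_comodule comC /=.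
have onlyx s : s \in S -> s \in C -> s = x.
  by move=> sS; apply: contraTeq => sx; apply: avoids; rewrite !inE sx.
have yC : y \notin C by apply: avoids; rewrite !inE eq_sym neq_xy.
apply/eqP/setI_eq1P; split=> //; apply: contraT => xC.
rewrite flip_comodule ?(negbTE xC) ?(negbTE yC) // in comC.
have [s sS sC] := hittingP hitS C comC.
by rewrite -(onlyx s) ?sC in xC.
Qed.

Lemma minset_hitting_flip_setD1 S : minset (hitting t) S -> 2 < #|S| ->
  exists x y, [/\ x \in S, x != y & hitting (flip t x y) (S :\ x)].
Proof.
move=> minS gt2S; have hitS := minsetp minS.
have [x] : exists x, x \in [set x in S | has_modular_private S x].
  by apply/card_gt0P; have := card_modular_private minS gt2S; lia.
rewrite inE => /andP[xS /has_modular_privateP[K privK modK]].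
have [y yS yx] := exists_neq x (ltnW gt2S); have [w [wS wx wy]] := exists_neq2 x y gt2S.
have [xy xw] : x != y /\ x != w by split; rewrite eq_sym.
have [hit_y|fail_y] := boolP (hitting (flip t x y) (S :\ x)); first by exists x, y.
have [hit_w|fail_w] := boolP (hitting (flip t x w) (S :\ x)); first by exists x, w.
have [C privC] := not_hitting_flip_setD1 hitS xS yS xy fail_y.
have [D privD] := not_hitting_flip_setD1 hitS xS wS xw fail_w.
have splitC := flip_private_split hitS gt2S yS xy privK privC.
have splitD := flip_private_split hitS gt2S wS xw privK privD.
have [comK /eqP trK] := andP privK.
have [[_ /eqP trC] [_ /eqP trD]] := (andP privC, andP privD).
have comK' : modular_comodule t K by rewrite /modular_comodule comK.
have [xK _ _] := iffLR setI_eq1P trK; have neq_yw : y != w by rewrite eq_sym.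
have yK := setI_eq1_notin trK yS yx; have wK := setI_eq1_notin trK wS wx.
have := split_comodules_meet tourn splitC splitD comK' xK yK wK neq_yw.
by rewrite (negbTE (setI_eq1_notin trC wS wx)) (negbTE (setI_eq1_notin trD yS yx)).
Qed.

End LargeHittingSets.

(** * Hitting sets with two elements *)

Section TwoElementHittingSets.

Variables (V : finType) (t : rel V).
Hypotheses (tourn : tournament_rel t) (gt4V : 4 < #|V|).
Implicit Types (C D K M N : {set V}) (a p q u v w x y z : V).

Lemma not_hitting_flip_set0 x y : x != y -> hitting t [set x; y] ->
  ~~ hitting (flip t x y) set0 ->
  exists2 N : {set V}, 1 < #|N| & split_comodule t x y N || split_comodule t y x N.
Proof.
move=> neq_xy /hitting2P sep /not_hitting[C comC _].
have [N nontrivN] : exists N, nontrivial_module (flip t x y) N.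
  by case/orP: comC; [exists C | exists (~: C)].
have [modN gt1N _] := and3P nontrivN.
have comN : comodule (flip t x y) N by rewrite /comodule nontrivN.
exists N => //; have [eq_xy|neq_xyN] := eqVneq (x \in N) (y \in N).
  rewrite flip_comodule // in comN.
  by have := sep N comN; rewrite eq_xy; case: (y \in N).
rewrite /split_comodule /split_module -(eq_comodule _ (flipC t x y)) comN.
rewrite -(eq_module _ (flipC t x y)) modN /=.
by case: (x \in N) neq_xyN; case: (y \in N).
Qed.

Lemma hitting2_setD1 x y M : hitting t [set x; y] -> y \notin M -> module t (M :\ x) ->
  #|M| <= 2.
Proof.
move=> hitxy yM modM; rewrite (cardsD1 x) -[2]/(1 + 1) leq_add ?leq_b1 //.
apply: (hitting_disjoint_module hitxy) => //.
  by apply/set0Pn; exists x; rewrite set21.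
by move=> s /set2P[]->; rewrite !inE ?eqxx // (negbTE yM) andbF.
Qed.

Definition pivot a : Prop :=
  forall K, modular_comodule t K -> a \in K /\ #|K| <= 2 \/ ~: K = [set a].

Section SplitModule.

Variables (x y : V) (N : {set V}).
Hypotheses (hitxy : hitting t [set x; y]) (split_comN : split_comodule t x y N).

Let splitN : split_module t x y N.
Proof. by case/andP: split_comN. Qed.

Lemma split_hitting2_card K : 1 < #|N| -> modular_comodule t K -> x \in K ->
  #|N| <= 2 /\ #|K| <= 2.
Proof.
move=> gt1N comK xK; have [comK' modK] := andP comK; have [_ _ yN] := and3P splitN.
have yK : y \notin K by have := hitting2P hitxy K comK'; rewrite xK => <-.
split; apply: (hitting2_setD1 hitxy) => //.
  exact: (split_moduleD1 tourn splitN comK).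
exact: (moduleD1_split tourn splitN gt1N).
Qed.

Lemma split_hitting2_setC1 K : modular_comodule t K -> y \in K ->
  K = ~: [set x] \/ #|K| <= 2 /\ N = ~: [set y].
Proof.
move=> comK yK; have [comK' modK] := andP comK.
have xK : x \notin K by rewrite (hitting2P hitxy K comK') yK.
have [subK|] := boolP (~: [set x] \subset K).
  left; apply/eqP; rewrite eqEsubset subK andbT.
  by apply/subsetP=> u uK; rewrite !inE (mem_notin_neq uK xK).
case/subsetPn=> w; rewrite !inE => wx wK; right.
have [_ xN _] := and3P splitN; have neq_xy := split_neq splitN.
have defN : N = ~: [set y].
  apply: (split_comodule_setC1 tourn split_comN comK yK xK hitxy) wK wx.
    by rewrite cards2 neq_xy.
  by apply/subsetP=> s /set2P[]->; rewrite in_setU ?xN ?yK ?orbT.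
split=> //; apply: (@hitting2_setD1 y x) => //; first by rewrite setUC.
apply: (moduleD1 (b := ~~ t y x)) => // u uK uy.
by apply: (split_end splitN); rewrite ?defN ?inE // (mem_notin_neq uK xK).
Qed.

Lemma split_hitting2_pivot : 1 < #|N| -> exists a, pivot a.
Proof.
move=> gt1N; have in_xy K : modular_comodule t K -> x \in K \/ y \in K.
  case/andP=> comK _; have := hitting2P hitxy K comK.
  by case: (y \in K) => ->; [right | left].
have [le2N|gt2N] := leqP #|N| 2.
  exists x => K comK; case: (in_xy K comK) => inK.
    by left; have [] := split_hitting2_card gt1N comK inK.
  case: (split_hitting2_setC1 comK inK) => [->|[_ defN]].
    by right; rewrite setCK.
  by move: le2N; rewrite defN cardsC1; lia.
exists y => K comK; left; case: (in_xy K comK) => inK.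
  by have [] := split_hitting2_card gt1N comK inK; lia.
case: (split_hitting2_setC1 comK inK) => [defK|[]//].
have comx : modular_comodule t [set x].
  by move: comK; rewrite /modular_comodule defK comoduleC module_set1 => /andP[->].
by have [] := split_hitting2_card gt1N comx (set11 x); lia.
Qed.

End SplitModule.

Section Pivot.

Variable a : V.
Hypothesis pivot_a : pivot a.

Definition pivotal K := [&& modular_comodule t K, a \in K & #|K| <= 2].

Lemma comodule_pivotal C : comodule t C -> pivotal C || pivotal (~: C).
Proof.
have modular_pivotal D : modular_comodule t D -> pivotal D || pivotal (~: D).
  move=> comD; case: (pivot_a comD) => [[aD le2D]|defD].
    by rewrite /pivotal comD aD le2D.
  have [comD' _] := andP comD.
  rewrite /pivotal /modular_comodule comoduleC comD' defD module_set1 set11 cards1.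
  exact: orbT.
by case/comodule_modular/orP=> /modular_pivotal //; rewrite setCK orbC.
Qed.

Lemma pivotal_sub K L : pivotal K -> pivotal L -> K \subset L -> K = L.
Proof.
case/and3P=> comK aK le2K /and3P[comL aL le2L] sKL.
have [comK' _] := andP comK; have [comL' modL] := andP comL.
apply/eqP; rewrite eqEcard sKL leqNgt; apply/negP=> ltKL.
have defK : K = [set a] by apply: card_le1_set1 => //; lia.
have modCL : modular_comodule t (~: L).
  rewrite /modular_comodule comoduleC comL' /=.
  case/orP: comK' => /and3P[modK gt1K _]; first by rewrite defK cards1 in gt1K.
  have -> : ~: L = ~: K :\: L.
    by apply/setP=> v; rewrite !inE; case: (v \in L) (subsetP sKL v) => //= /contra->.
  by apply: (moduleD tourn aL) => //; rewrite inE negbK.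
case: (pivot_a modCL) => [[]|]; first by rewrite inE aL.
by rewrite setCK => defL; rewrite defL defK ltnn in ltKL.
Qed.

Lemma pivotal_unique K L : pivotal K -> pivotal L -> K = L.
Proof.
move=> pivK pivL; have [[comK aK le2K] [comL aL le2L]] := (and3P pivK, and3P pivL).
have [sLK|/subsetPn[m mL mK]] := boolP (L \subset K).
  by rewrite (pivotal_sub pivL pivK).
have cardU : #|K :|: L| <= 4 by apply: leq_trans (leq_card_setU K L) _; lia.
have [v _ vU] : exists2 v, v \in [set: V] & v \notin K :|: L.
  by apply: ltn_card_exists; rewrite cardsT; lia.
have [[_ modK] [_ modL]] := (andP comK, andP comL).
have aU : a \in K :|: L by rewrite inE aK.
have mU : m \in K :|: L by rewrite inE mL orbT.
have comU := module_comodule (moduleU aK aL modK modL) aU mU (mem_notin_neq aK mK) vU.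
have pivU : pivotal (K :|: L).
  case: (pivot_a comU) => [[_ le2U]|defU]; first by rewrite /pivotal comU aU le2U.
  by have := set11 a; rewrite -defU inE aU.
by rewrite (pivotal_sub pivK pivU (subsetUl _ _)) -(pivotal_sub pivL pivU (subsetUr _ _)).
Qed.

Lemma exists_unique_comodule C0 : comodule t C0 ->
  exists K, [/\ modular_comodule t K, #|K| <= 2 &
    forall C, comodule t C -> C = K \/ C = ~: K].
Proof.
move=> com0; have [K pivK] : exists K, pivotal K.
  by case/orP: (comodule_pivotal com0); [exists C0 | exists (~: C0)].
have [comK _ le2K] := and3P pivK; exists K; split=> // C /comodule_pivotal/orP[]pivC.
  by left; apply: pivotal_unique.
by right; rewrite -(pivotal_unique pivC pivK) setCK.
Qed.

End Pivot.

(** * Tournaments with a single comodule up to complementation *)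

Section UniqueComodule.

Variable K : {set V}.
Hypotheses (comK : modular_comodule t K) (le2K : #|K| <= 2).
Hypothesis only_K : forall C, comodule t C -> C = K \/ C = ~: K.

Lemma unique_comodule_hitting2 x y : x \in K -> y \notin K -> hitting t [set x; y].
Proof.
by move=> xK yK; apply/hitting2P=> C /only_K[]->; rewrite ?inE ?negbK xK (negbTE yK).
Qed.

Lemma unique_comodule_split x y : x \in K -> y \notin K -> ~~ hitting (flip t x y) set0 ->
  exists2 N : {set V}, split_comodule t x y N & #|N| <= 2.
Proof.
move=> xK yK fail; have neq_xy := mem_notin_neq xK yK.
have hitxy := unique_comodule_hitting2 xK yK.
have [N gt1N /orP[]splitN] := not_hitting_flip_set0 neq_xy hitxy fail.
  by exists N; have [] := split_hitting2_card hitxy splitN gt1N comK xK.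
rewrite setUC in hitxy.
have [defK|[_ defN]] := split_hitting2_setC1 hitxy splitN comK xK.
  by move: le2K; rewrite defK cardsC1; lia.
exists [set x]; rewrite ?cards1 // /split_comodule /split_module module_set1 !inE eqxx.
have [comN _] := andP splitN.
by rewrite -comoduleC -defN (eq_comodule _ (flipC t x y)) comN eq_sym neq_xy.
Qed.

Lemma unique_set1_flip x : K = [set x] -> exists2 y, x != y & hitting (flip t x y) set0.
Proof.
move=> defK; have xK : x \in K by rewrite defK set11.
have [/existsP[y /andP[]]|] := boolP [exists y, (x != y) && hitting (flip t x y) set0].
  by exists y.
rewrite negb_exists => /forallP fail.
have partner y : exists z, y \notin K ->
    exists2 N, split_comodule t x y N & N \subset [set x; z].
  have [yK|yK] := boolP (y \in K); first by exists x.
  have failxy : ~~ hitting (flip t x y) set0.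
    by have := fail y; rewrite (mem_notin_neq xK yK).
  have [N splitN le2N] := unique_comodule_split xK yK failxy.
  have [_ /and3P[_ xN _]] := andP splitN.
  have le1N : #|N :\ x| <= 1 by move: le2N; rewrite (cardsD1 x) xN.
  have [N0|[z zN]] := set_0Vmem (N :\ x).
    by exists x => _; exists N; rewrite // setUid -setD_eq0 N0.
  exists z => _; exists N; rewrite // -(setD1K xN).
  by rewrite (card_le1_set1 zN le1N).
have [f partnerP] := fin_all_exists partner.
have : #|~: K| <= 3.
  apply: (card_le3_chooses (f := f)) => y y'; rewrite !in_setC => yK y'K neq_y.
  have [N splitN /subsetP sN] := partnerP y yK.
  have [N' splitN' /subsetP sN'] := partnerP y' y'K.
  case/orP: (split_comodules_meet tourn splitN splitN' comK xK yK y'K neq_y).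
    by move=> /sN/set2P[y'x|]; [rewrite y'x xK in y'K | left].
  by move=> /sN'/set2P[yx|]; [rewrite yx xK in yK | right].
by rewrite defK cardsC1; lia.
Qed.

Lemma unique_pair_flip p q y1 y2 : p \in K -> q \in K -> p != q ->
  y1 \notin K -> y2 \notin K -> y1 != y2 -> t y1 p = t q p -> t y2 p = t q p ->
  hitting (flip t p y1) set0 || hitting (flip t p y2) set0.
Proof.
move=> pK qK neq_pq y1K y2K neq_y ty1 ty2.
apply: contraT; rewrite negb_or => /andP[fail1 fail2].
have [N1 split1 _] := unique_comodule_split pK y1K fail1.
have [N2 split2 _] := unique_comodule_split pK y2K fail2.
have qp : q != p by rewrite eq_sym.
have [_ modK] := andP comK.
have avoids y z N :
    y \notin K -> z \notin K -> split_comodule t p y N -> t z p = t q p -> z \notin N.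
  move=> yK zK /andP[_ splitN] tzp; have pz := mem_notin_neq pK zK; apply/negP=> zN.
  have zp : z != p by rewrite eq_sym.
  have := split_arc tourn splitN modK pK yK qK qp zN zp.
  by rewrite -tzp (tournament_swap tourn pz); case: (t p z).
have := split_comodules_meet tourn split1 split2 comK pK y1K y2K neq_y.
by rewrite (negbTE (avoids y1 y2 N1 _ _ _ _)) ?(negbTE (avoids y2 y1 N2 _ _ _ _)).
Qed.

Lemma unique_comodule_flip : exists x y, x != y /\ hitting (flip t x y) set0.
Proof.
have [comK' modK] := andP comK; have [x xK] := comodule_neq0 comK'.
have [le1K|gt1K] := leqP #|K| 1.
  by have [y] := unique_set1_flip (card_le1_set1 xK le1K); exists x, y.
have [m mK mx] := exists_neq x gt1K; have xm : x != m by rewrite eq_sym.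
have [y1 [y2 [y1K y2K neq_y same]]] :
    exists y1 y2, [/\ y1 \notin K, y2 \notin K, y1 != y2 & t y1 x = t y2 x].
  have : 2 < #|~: K| by have := cardsC K; lia.
  case/card_gt2P=> a [b [c [[]]]]; rewrite !inE => aK bK cK [ab bc ca].
  have [eq_ab|neq_ab] := eqVneq (t a x) (t b x); first by exists a, b.
  have [eq_bc|neq_bc] := eqVneq (t b x) (t c x); first by exists b, c.
  exists c, a; split=> //; move: neq_ab neq_bc.
  by case: (t a x); case: (t b x); case: (t c x).
suff [p [q [pK qK neq_pq [ty1 ty2]]]] : exists p q,
    [/\ p \in K, q \in K, p != q & t y1 p = t q p /\ t y2 p = t q p].
  have [py1 py2] := (mem_notin_neq pK y1K, mem_notin_neq pK y2K).
  case/orP: (unique_pair_flip pK qK neq_pq y1K y2K neq_y ty1 ty2);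
    by [exists p, y1 | exists p, y2].
have [tmx|tmx] := eqVneq (t y1 x) (t m x).
  by exists x, m; rewrite -same.
exists m, x; rewrite (module_in modK mK xK y1K) (module_in modK mK xK y2K) -same.
rewrite (tournament_swap tourn mx).
by split=> //; move: tmx; case: (t y1 x); case: (t m x).
Qed.

End UniqueComodule.

Lemma minset_hitting2_flip S : minset (hitting t) S -> #|S| = 2 ->
  exists x y, x != y /\ hitting (flip t x y) set0.
Proof.
move=> minS card2S; have /cards2P[x [y [neq_xy defS]]] : #|S| == 2 by rewrite card2S.
have xS : x \in S by rewrite defS set21.
have [C0 /andP[com0 _]] := minset_hitting_private minS xS.
have hitxy : hitting t [set x; y] by rewrite -defS (minsetp minS).
have [|fail] := boolP (hitting (flip t x y) set0); first by exists x, y.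
have [N gt1N splitN] := not_hitting_flip_set0 neq_xy hitxy fail.
have [a pivot_a] : exists a, pivot a.
  case/orP: splitN => splitN; first exact: split_hitting2_pivot splitN gt1N.
  by rewrite setUC in hitxy; apply: split_hitting2_pivot splitN gt1N.
have [K [comK le2K only_K]] := exists_unique_comodule pivot_a com0.
exact: unique_comodule_flip comK le2K only_K.
Qed.

End TwoElementHittingSets.

(** * Minimal comodules and a small hitting set *)

Section MinimalComodules.

Variables (V : finType) (t : rel V).
Hypothesis tourn : tournament_rel t.
Implicit Types (A B C M : {set V}) (u v w x y z : V).

Notation mincomodule := (minset (comodule t)).

Lemma mincomodule_sub_module C M v : mincomodule C -> module t M -> M \subset C ->
  v \in C -> v \notin M -> #|M| <= 1.
Proof.
move=> minC modM sMC vC vM; rewrite leqNgt; apply/negP=> /card_gt1P[x [y [xM yM neq_xy]]].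
have /andP[comM _] := module_comodule modM xM yM neq_xy vM.
by rewrite (minsetinf minC comM sMC) vC in vM.
Qed.

Lemma mincomodule_moduleC_cover A B x z : mincomodule B ->
  nontrivial_module t A -> nontrivial_module t (~: B) ->
  x \in A -> x \in B -> z \in A -> z \notin B -> B \subset A.
Proof.
move=> minB modA modB xA xB zA zB; apply/subsetP=> v vB; apply: contraT => vA.
have zB' : z \in ~: B by rewrite inE.
have vU : v \notin A :|: ~: B by rewrite !inE negb_or vA vB.
have comU : comodule t (~: (A :|: ~: B)).
  by rewrite comoduleC /comodule (nontrivial_moduleU modA modB zA zB' vU).
have sUB : ~: (A :|: ~: B) \subset B by rewrite setCU setCK subsetIr.
by move/setP/(_ x): (minsetinf minB comU sUB); rewrite !inE xA xB.
Qed.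

Lemma mincomodule_meet_modules A B x : mincomodule A -> mincomodule B ->
  module t A -> module t B -> x \in A -> x \in B ->
  ~~ (A \subset B) -> ~~ (B \subset A) -> #|A| = 2.
Proof.
move=> minA minB modA modB xA xB /subsetPn[a aA aB] /subsetPn[b bB bA].
have le1I : #|A :&: B| <= 1.
  apply: (mincomodule_sub_module minA (moduleI modA modB) (subsetIl _ _) aA).
  by rewrite inE (negbTE aB) andbF.
have le1D : #|A :\: B| <= 1.
  apply: (mincomodule_sub_module minA (moduleD tourn bB bA modA modB) (subsetDl _ _) xA).
  by rewrite inE xB.
have gt0I : 0 < #|A :&: B| by apply/card_gt0P; exists x; rewrite inE xA.
have gt0D : 0 < #|A :\: B| by apply/card_gt0P; exists a; rewrite inE aA aB.
by rewrite -(cardsID B A); lia.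
Qed.

Lemma mincomodule_meet A B x : mincomodule A -> mincomodule B -> A != B ->
  x \in A -> x \in B -> nontrivial_module t A /\ #|A| = 2.
Proof.
move=> minA minB neqAB xA xB; have [comA comB] := (minsetp minA, minsetp minB).
have subAB : ~~ (A \subset B).
  by apply: contra neqAB => sAB; rewrite (minsetinf minB comA sAB).
have subBA : ~~ (B \subset A).
  by apply: contra neqAB => sBA; rewrite (minsetinf minA comB sBA).
have [[a aA aB] [b bB bA]] := (subsetPn subAB, subsetPn subBA).
case/orP: (comA) => modA; case/orP: (comB) => modB.
- have [[modA' _ _] [modB' _ _]] := (and3P modA, and3P modB).
  by split=> //; apply: mincomodule_meet_modules minA minB modA' modB' xA xB subAB subBA.
- by rewrite (mincomodule_moduleC_cover minB modA modB xA xB aA aB) in subBA.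
- by rewrite (mincomodule_moduleC_cover minA modB modA xB xA bB bA) in subAB.
have [disj|] := boolP (~: A \subset B).
  rewrite -(comoduleC t A) in comA; have defB := minsetinf minB comA disj.
  by rewrite -defB inE xA in xB.
case/subsetPn=> v vA vB; have [vB' aB'] : v \in ~: B /\ a \in ~: B by rewrite !inE.
have vA' : v \notin A by rewrite inE in vA.
have /subsetP/(_ x xA) := mincomodule_moduleC_cover minA modB modA aB' aA vB' vA'.
by rewrite inE xB.
Qed.

Definition extremes : {set V} := [set x | comodule t [set x]].

Lemma card_extremes : #|extremes| <= 2.
Proof.
rewrite leqNgt; apply/negP=> /card_gt2P[a [b [c [[]]]]].
rewrite !inE => coma comb comc [ab bc ca].
have [ba cb ac] : [/\ b != a, c != b & a != c] by split; rewrite eq_sym.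
move: (comodule_set1 coma ba ca) (comodule_set1 comb ab cb) (comodule_set1 comc ac bc).
rewrite (tournament_swap tourn ab) (tournament_swap tourn ac) (tournament_swap tourn cb).
by case: (t a b); case: (t a c); case: (t c b).
Qed.

Definition outdegree x : nat := #|[set v | t x v]|.

Lemma odd_outdegree_module2 x y : x != y -> module t [set x; y] ->
  odd (outdegree x) = ~~ odd (outdegree y).
Proof.
have odd_of_arc p q : p != q -> module t [set p; q] -> t p q ->
    odd (outdegree p) = ~~ odd (outdegree q).
  move=> neq_pq modpq tpq; have [irr _] := tourn.
  rewrite /outdegree (_ : [set v | t p v] = q |: [set v | t q v]); last first.
    apply/setP=> v; rewrite !inE; have [->|vq] //= := eqVneq v q.
    have [->|vp] := eqVneq v p; first by rewrite (tournament_swap tourn neq_pq) tpq irr.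
    by apply: (module_out tourn modpq); rewrite !inE ?eqxx ?orbT // negb_or vp.
  by rewrite cardsU1 inE irr.
move=> neq_xy modxy; have [|txy] := boolP (t x y); first exact: odd_of_arc.
have yx : y != x by rewrite eq_sym.
by rewrite (odd_of_arc y x) ?negbK // 1?setUC // (tournament_swap tourn neq_xy).
Qed.

Definition large_mincomodules : {set {set V}} :=
  [set C | [&& mincomodule C, 1 < #|C| & ~~ (nontrivial_module t C && (#|C| == 2))]].

Definition representatives : {set V} :=
  transversal large_mincomodules (cover large_mincomodules).

Lemma large_mincomodules_partition :
  partition large_mincomodules (cover large_mincomodules).
Proof.
apply/and3P; split=> //; last by rewrite inE cards0 andbF.
apply/trivIsetP=> A B; rewrite !inE => /and3P[minA _ smallA] /and3P[minB _ _] neqAB.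
rewrite -setI_eq0; apply/eqP/setP=> x; rewrite !inE; apply/negbTE/negP=> /andP[xA xB].
have [modA cardA] := mincomodule_meet minA minB neqAB xA xB.
by rewrite modA cardA in smallA.
Qed.

Definition bicolouring x : bool :=
  if x \in cover large_mincomodules then x \in representatives else odd (outdegree x).

Lemma bicolouring_large C b :
  C \in large_mincomodules -> exists2 x, x \in C & bicolouring x = b.
Proof.
move=> largeC; have gt1C : 1 < #|C| by move: largeC; rewrite inE => /and3P[].
have /and3P[_ _ trans] := transversalP large_mincomodules_partition.
have /cards1P[r trC] := forall_inP trans C largeC.
have inC x : x \in C -> bicolouring x = (x == r).
  move=> xC; have covx : x \in cover large_mincomodules by apply/bigcupP; exists C.
  rewrite /bicolouring covx.
  by rewrite -in_set1 -trC inE xC andbT.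
have /setIP[_ rC] : r \in representatives :&: C by rewrite trC set11.
case: b; first by exists r; rewrite ?inC ?eqxx.
by have [x xC xr] := exists_neq r gt1C; exists x; rewrite ?inC // (negbTE xr).
Qed.

Lemma bicolouring_mincomodule C b : mincomodule C -> 1 < #|C| ->
  exists2 x, x \in C & bicolouring x = b.
Proof.
move=> minC gt1C.
have [small|] := boolP (nontrivial_module t C && (#|C| == 2)); last first.
  by move=> large; apply: bicolouring_large; rewrite inE minC gt1C.
have not_cover x : x \in C -> x \notin cover large_mincomodules.
  move=> xC; apply/negP=> /bigcupP[B]; rewrite inE => /and3P[minB _ large] xB.
  have neqBC : B != C by apply: contraNneq large => ->.
  have [modB cardB] := mincomodule_meet minB minC neqBC xB xC.
  by rewrite modB cardB in large.
case/andP: small => /and3P[modC _ _] /cards2P[p [q [neq_pq defC]]].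
have [pC qC] : p \in C /\ q \in C by rewrite defC set21 set22.
have odd_pq : odd (outdegree p) = ~~ odd (outdegree q).
  by apply: odd_outdegree_module2; rewrite -?defC.
have colour x : x \in C -> bicolouring x = odd (outdegree x).
  by move=> xC; rewrite /bicolouring (negbTE (not_cover x xC)).
have [pb|pb] := eqVneq (odd (outdegree p)) b; first by exists p; rewrite ?colour.
by exists q; rewrite ?colour //; move: pb; rewrite odd_pq; case: (odd _) b => -[].
Qed.

Definition colour_class b : {set V} := extremes :|: [set x | bicolouring x == b].

Lemma colour_class_hitting b : hitting t (colour_class b).
Proof.
apply/hittingP=> C comC; have [M minM /subsetP sMC] := minset_exists comC.
suff [x xM xb] : exists2 x, x \in M & x \in colour_class b by exists x => //; apply: sMC.
have [x xM] := comodule_neq0 (minsetp minM).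
have [le1M|gt1M] := leqP #|M| 1.
  by exists x; rewrite // !inE -(card_le1_set1 xM le1M) (minsetp minM).
have [y yM <-] := bicolouring_mincomodule b minM gt1M.
by exists y; rewrite // !inE eqxx orbT.
Qed.

Lemma card_colour_classes :
  #|colour_class true| + #|colour_class false| = #|V| + #|extremes|.
Proof.
rewrite /colour_class; set P := [set x | bicolouring x == true].
have -> : [set x | bicolouring x == false] = ~: P.
  by apply/setP=> x; rewrite !inE; case: (bicolouring x).
have := cardsUI extremes P; have := cardsUI extremes (~: P); have := cardsC P.
by have := cardsID P extremes; rewrite setDE; lia.
Qed.

Lemma small_hitting : exists2 S, hitting t S & #|S|.*2 <= #|V| + 2.
Proof.
have := card_colour_classes; have := card_extremes => le2 cards.
have [le_tf|lt_ft] := leqP #|colour_class true| #|colour_class false|.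
  by exists (colour_class true); [exact: colour_class_hitting | lia].
by exists (colour_class false); [exact: colour_class_hitting | lia].
Qed.

End MinimalComodules.

(** * The decomposability index *)

Section Reversals.

Variable V : finType.
Implicit Types (t : rel V) (S : {set V}).

Definition reversed_arcs t t' : {set V * V} := [set e | t e.1 e.2 && ~~ t' e.1 e.2].

Definition indecomposable_within t k : Prop :=
  exists t', [/\ tournament_rel t', hitting t' set0 & #|reversed_arcs t t'| <= k].

Lemma indecomposable_within_leq t k l :
  k <= l -> indecomposable_within t k -> indecomposable_within t l.
Proof.
by move=> le_kl [t' [tourn' hit' le_k]]; exists t'; split=> //; apply: leq_trans le_kl.
Qed.

Lemma indecomposable_within0 t :
  tournament_rel t -> hitting t set0 -> indecomposable_within t 0.
Proof.
move=> tourn hit; exists t; split=> //.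
by rewrite leqn0 cards_eq0; apply/eqP/setP=> e; rewrite !inE andbN.
Qed.

Lemma reversed_arcs_flip t t' x y : tournament_rel t -> x != y ->
  reversed_arcs t t' \subset
    (if t x y then (x, y) else (y, x)) |: reversed_arcs (flip t x y) t'.
Proof.
move=> tourn neq_xy; apply/subsetP=> -[a b]; rewrite !inE /= => /andP[tab ->].
rewrite andbT /flip tab /=.
have [ends|_] := boolP ((a == x) && (b == y) || _); last by rewrite orbT.
apply/orP; left; case/orP: ends tab => /andP[/eqP-> /eqP->]; first by move->.
by rewrite (tournament_swap tourn neq_xy) => /negbTE->.
Qed.

Lemma indecomposable_within_flip t x y k : tournament_rel t -> x != y ->
  indecomposable_within (flip t x y) k -> indecomposable_within t k.+1.
Proof.
move=> tourn neq_xy [t' [tourn' hit' le_k]]; exists t'; split=> //.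
apply: leq_trans (subset_leq_card (reversed_arcs_flip t' tourn neq_xy)) _.
by rewrite cardsU1 -add1n leq_add ?leq_b1.
Qed.

Lemma minset_hitting_flip_uphalf t S :
  4 < #|V| -> tournament_rel t -> minset (hitting t) S -> S != set0 ->
  exists x y S',
    [/\ x != y, hitting (flip t x y) S' & uphalf #|S'| < uphalf #|S|].
Proof.
move=> gt4V tourn minS S0; have neq1 := minset_hitting_neq1 minS.
have gt1S : 1 < #|S| by move: S0 neq1; rewrite -card_gt0; lia.
have [le3S|gt3S] := leqP #|S| 3; last first.
  have [x [y [xS yS neq_xy hit]]] := minset_hitting_flip_setD2 tourn minS gt3S.
  exists x, y, (S :\: [set x; y]); split=> //.
  have -> : #|S| = #|S :\: [set x; y]|.+2.
    by rewrite (cardsD1 x) xS (cardsD1 y) !inE eq_sym neq_xy yS -setDDl.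
  by rewrite /= ltnS.
have [le2S|gt2S] := leqP #|S| 2.
  have card2S : #|S| = 2 by lia.
  have [x [y [neq_xy hit]]] := minset_hitting2_flip tourn gt4V minS card2S.
  by exists x, y, set0; rewrite cards0 card2S.
have [x [y [xS neq_xy hit]]] := minset_hitting_flip_setD1 tourn minS gt2S.
exists x, y, (S :\ x); split=> //.
have card3S : #|S| = 3 by lia.
have -> : #|S :\ x| = 2 by have := cardsD1 x S; rewrite xS; lia.
by rewrite card3S.
Qed.

Lemma hitting_indecomposable_within t S : 4 < #|V| -> tournament_rel t -> hitting t S ->
  indecomposable_within t (uphalf #|S|).
Proof.
move=> gt4V; have [k] := ubnP (uphalf #|S|); elim: k t S => // k IHk t S lt_k tourn hitS.
have [M minM sMS] := minset_exists hitS.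
have le_MS : uphalf #|M| <= uphalf #|S| by apply: uphalf_leq (subset_leq_card sMS).
apply: (indecomposable_within_leq le_MS).
have [M0|M0] := eqVneq M set0.
  by rewrite M0 cards0; apply: indecomposable_within0; rewrite // -M0 (minsetp minM).
have [x [y [S' [neq_xy hit' lt_S']]]] := minset_hitting_flip_uphalf gt4V tourn minM M0.
apply: (indecomposable_within_leq lt_S').
apply: (indecomposable_within_flip tourn neq_xy).
by apply: IHk (flip_tournament tourn neq_xy) hit'; lia.
Qed.

End Reversals.

Section DecomposabilityIndex.

Variables (V : finType) (T : tournament V).
Implicit Types (B : {set V * V}) (m k : nat).

Definition arc_rel : rel V := [rel x y | (x, y) \in arcs T].

Lemma arc_rel_tournament : tournament_rel arc_rel.
Proof.
split=> [x|x y neq_xy]; rewrite /arc_rel /=; first exact/negbTE/arcs_irr.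
by have := arcs_tot T neq_xy; do 2![case: (_ \in arcs T)].
Qed.

Lemma indecomposable_module M : indecomposable T -> is_module T M -> 1 < #|M| -> M = setT.
Proof. by move=> indec /indec[->|[x ->]|//]; rewrite ?cards0 ?cards1. Qed.

Lemma indecomposable_hitting : indecomposable T <-> hitting arc_rel set0.
Proof.
split=> [indec|/hittingP hit M modM].
  apply/hittingP=> C comC.
  have [M /and3P[/moduleP modM gt1M]] : exists M, nontrivial_module arc_rel M.
    by case/orP: comC; [exists C | exists (~: C)].
  by rewrite (indecomposable_module indec modM gt1M) eqxx.
have := hit M; rewrite /comodule /nontrivial_module (introT moduleP modM) /=.
have [gt1M|le1M] := ltnP 1 #|M|.
  have [-> _|_ /(_ isT)[x]] := eqVneq M setT; first exact: Or33.
  by rewrite inE.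
have [->|[x xM]] := set_0Vmem M; first by move=> _; apply: Or31.
by move=> _; apply: Or32; exists x; apply: card_le1_set1.
Qed.

Definition indec_afterb m : bool :=
  [exists B : {set V * V}, [&& B \subset arcs T, #|B| == m &
     hitting (fun x y => (x, y) \in inv_arcs T B) set0]].

End DecomposabilityIndex.

Lemma reversed_arcs_sub (V : finType) (T : tournament V) (t : rel V) :
  reversed_arcs (arc_rel T) t \subset arcs T.
Proof. by apply/subsetP=> -[x y]; rewrite inE => /andP[]. Qed.

Lemma arc_rel_Inv_reversed (V : finType) (T : tournament V) (t : rel V) :
  tournament_rel t -> arc_rel (Inv (reversed_arcs_sub T t)) =2 t.
Proof.
move=> tourn x y; rewrite /arc_rel /= in_inv_arcs !inE /=.
have [->|neq_xy] := eqVneq x y; first by rewrite tourn.1 (negbTE (arcs_irr T y)).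
have := tournament_swap (arc_rel_tournament T) neq_xy.
rewrite /arc_rel (tournament_swap tourn neq_xy) /= => ->.
by case: (_ \in _); case: (t x y).
Qed.

Lemma indec_afterP (V : finType) (T : tournament V) m :
  reflect (indec_after T m) (indec_afterb T m).
Proof.
apply: (iffP existsP) => [[B /and3P[sBT /eqP cardB hitB]]|[B [sBT [<- indecB]]]].
  by exists B, sBT; split=> //; apply/indecomposable_hitting.
by exists B; rewrite sBT eqxx; apply/(indecomposable_hitting (Inv sBT)).
Qed.

Lemma exists_indec_after (V : finType) (T : tournament V) : 4 < #|V| ->
  exists2 m, indec_after T m & m <= ceil_div #|V|.+1 4.
Proof.
move=> gt4V; have tournT := arc_rel_tournament T.
have [S hitS cardS] := small_hitting tournT.
have [t [tourn hit le_t]] := hitting_indecomposable_within gt4V tournT hitS.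
exists #|reversed_arcs (arc_rel T) t|.
  exists (reversed_arcs (arc_rel T) t), (reversed_arcs_sub T t); split=> //.
  by apply/indecomposable_hitting; rewrite (eq_hitting _ (arc_rel_Inv_reversed T tourn)).
apply: leq_trans le_t _; rewrite leq_uphalf_double.
have : #|V|.+1 <= ceil_div #|V|.+1 4 * 4 by rewrite -ceil_div_leq.
by lia.
Qed.

Lemma exists_decomposability_index (V : finType) (T : tournament V) : 4 < #|V| ->
  exists2 k, decomposability_index T k & k <= ceil_div #|V|.+1 4.
Proof.
move=> gt4V; have [m after_m le_m] := exists_indec_after T gt4V.
have reachable : exists k, indec_afterb T k by exists m; apply/indec_afterP.
have [k /indec_afterP after_k min_k] := ex_minnP reachable.
have least j : indec_after T j -> k <= j by move/indec_afterP; apply: min_k.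
by exists k; [split | apply: leq_trans (least m after_m) le_m].
Qed.

(** * The transitive tournament *)

Section Transitive.

Variable n : nat.
Implicit Types (B : {set 'I_n * 'I_n}) (v x y : 'I_n).

Definition lt_arcs : {set 'I_n * 'I_n} := [set e : 'I_n * 'I_n | e.1 < e.2].

Lemma lt_arcs_irr x : (x, x) \notin lt_arcs.
Proof. by rewrite inE ltnn. Qed.

Lemma lt_arcs_tot x y : x != y -> ((x, y) \in lt_arcs) (+) ((y, x) \in lt_arcs).
Proof. by rewrite !inE -val_eqE /=; case: ltngtP. Qed.

Definition transitive_tournament : tournament 'I_n := Tournament lt_arcs_irr lt_arcs_tot.

Definition endpoints B : {set 'I_n} := [set e.1 | e in B] :|: [set e.2 | e in B].

Lemma card_endpoints B : #|endpoints B| <= #|B|.*2.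
Proof.
apply: leq_trans (leq_card_setU _ _) _.
by rewrite -addnn leq_add // leq_imset_card.
Qed.

Section Reversed.

Variable B : {set 'I_n * 'I_n}.
Hypothesis sBT : B \subset arcs transitive_tournament.
Hypotheses (indecB : indecomposable (Inv sBT)) (gt2n : 2 < n).

Lemma arcs_Inv_endpoints x v : (x \notin endpoints B) || (v \notin endpoints B) ->
  ((v, x) \in arcs (Inv sBT)) = (v < x).
Proof.
move=> untouched.
have endpointsP e : e \in B -> (e.1 \in endpoints B) /\ (e.2 \in endpoints B).
  by move=> eB; rewrite !inE !imset_f ?orbT.
have [/negbTE vxB /negbTE xvB] : (v, x) \notin B /\ (x, v) \notin B.
  by split; apply: contraL untouched => /endpointsP[/= -> ->].
by rewrite [arcs _]/(inv_arcs _ B) in_inv_arcs vxB xvB orbF andbT inE.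
Qed.

Lemma extreme_in_endpoints x :
  (forall v, x <= v) \/ (forall v, v <= x) -> x \in endpoints B.
Proof.
move=> extreme; apply: contraT => xB.
have /setP/(_ x) : ~: [set x] = setT.
  apply: (indecomposable_module indecB); last by rewrite cardsC1 card_ord; lia.
  move=> a b v; rewrite !in_setC !in_set1 negbK => ax bx /eqP->.
  rewrite !arcs_Inv_endpoints ?xB ?orbT //; move: ax bx; rewrite -!val_eqE /=.
  by case: extreme => ext; have := ext a; have := ext b; lia.
by rewrite !inE eqxx.
Qed.

Lemma consecutive_endpoints x y : y = x.+1 :> nat ->
  (x \in endpoints B) || (y \in endpoints B).
Proof.
move=> def_y; apply: contraT; rewrite negb_or => /andP[xB yB].
have neq_xy : x != y by rewrite -val_eqE /= def_y; lia.
have card_xy : #|[set x; y]| = 2 by rewrite cards2 neq_xy.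
suff xyT : [set x; y] = setT by move: gt2n; rewrite -[n]card_ord -cardsT -xyT card_xy.
apply: (indecomposable_module indecB); rewrite ?card_xy // => a b v.
have before u : u \in [set x; y] -> v \notin [set x; y] ->
    ((v, u) \in arcs (Inv sBT)) = (v < x).
  move=> uxy; rewrite in_set2 negb_or -!val_eqE /= => vxy.
  rewrite arcs_Inv_endpoints; last by case/set2P: uxy => ->; rewrite ?xB ?yB.
  by case/set2P: uxy => ->; lia.
by move=> axy bxy vxy; rewrite !before.
Qed.

Lemma gap_endpoints (j : 'I_n.+1) :
  exists2 x, x \in endpoints B & (x == j :> nat) || (x.+1 == j).
Proof.
have lt_jn1 := ltn_ord j.
have [j0|gt0j] := posnP j.
  have gt0n : 0 < n by lia.
  by exists (Ordinal gt0n); [apply: extreme_in_endpoints; left | rewrite j0].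
have lt_j1n : j.-1 < n by lia.
have [lt_jn|le_nj] := ltnP j n.
  have [] := orP (@consecutive_endpoints (Ordinal lt_j1n) (Ordinal lt_jn) _).
  - by rewrite /= prednK.
  - by exists (Ordinal lt_j1n); rewrite //= prednK // eqxx orbT.
  - by exists (Ordinal lt_jn); rewrite //= eqxx.
exists (Ordinal lt_j1n); last by rewrite /= prednK // eqxx orbT.
by apply: extreme_in_endpoints; right=> v /=; have := ltn_ord v; lia.
Qed.

(* The [n.+1] gaps before, between and after the vertices each touch an endpoint of a
   reversed arc, and every vertex touches two gaps. *)
Lemma transitive_lower_bound : n.+1 <= #|B| * 4.
Proof.
pose gaps := [set widen_ord (leqnSn n) x | x in endpoints B] :|:
  [set lift ord0 x | x in endpoints B].
have all_gaps : [set: 'I_n.+1] \subset gaps.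
  apply/subsetP=> j _; apply/setUP.
  have [x xB /orP[]/eqP def_j] := gap_endpoints j; [left | right].
    by apply/imsetP; exists x => //; apply: val_inj.
  by apply/imsetP; exists x => //; apply: val_inj.
have le_gaps : #|gaps| <= #|endpoints B|.*2.
  apply: leq_trans (leq_card_setU _ _) _.
  by rewrite -addnn leq_add // leq_imset_card.
have := leq_trans (subset_leq_card all_gaps) le_gaps; rewrite cardsT card_ord.
by have := card_endpoints B; lia.
Qed.

End Reversed.

End Transitive.

Theorem theorem1 (n : nat) (n_ge5 : 5 <= n) :
  max_decomposability_index n (ceil_div n.+1 4).
Proof.
split=> [|V T card_V]; last first.
  have [|k index_k le_k] := exists_decomposability_index T; first by rewrite card_V.
  by exists k; rewrite -card_V.
exists 'I_n, (transitive_tournament n); split; first exact: card_ord.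
have [|k index_k le_k] := exists_decomposability_index (transitive_tournament n).
  by rewrite card_ord.
suff -> : ceil_div n.+1 4 = k by [].
rewrite card_ord in le_k; apply/eqP; rewrite eqn_leq le_k andbT ceil_div_leq //.
have [[B [sBT [<- indecB]]] _] := index_k.
by apply: (transitive_lower_bound indecB); lia.
Qed.
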